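(* Let $f(j)=j^j$. No minimal interval exchange transformation has an $f$-thick mixing sequence.
   Context: $\lambda$ denotes Lebesgue measure. An interval exchange transformation (IET) is an invertible piecewise orientation-preserving isometry $T$ of the interval $[0,1)$, such that $[0,1)$ is divided into finitely many ($d$) left-closed, right-open subintervals that are permuted by $T$. A transformation is minimal if the orbit of every point is dense. A sequence of natural numbers $a_1<a_2<\dots$ is a mixing sequence for $T$ if for any measurable sets $A,B$ we have $\lim_{i\to\infty}\lambda(T^{-a_i}A\cap B)=\lambda(A)\lambda(B)$. Given an increasing function $f:\mathbb{N}\to\mathbb{N}$, an increasing sequence of natural numbers $a_1<a_2<\dots$ is $f$-thick if $[j,f(j)]\subset\{a_i\}_{i=1}^\infty$ for infinitely many $j$, where $[j,f(j)]$ denotes the integers between $j$ and $f(j)$ inclusive. *)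

(* Defs.v *)
From mathcomp Require Import all_boot all_order all_algebra.
From mathcomp Require Import all_classical all_reals all_analysis.
Set Implicit Arguments.
Unset Strict Implicit.
Unset Printing Implicit Defensive.
Import Order.TTheory GRing.Theory Num.Theory.
Import numFieldNormedType.Exports.

Local Open Scope classical_set_scope.
Local Open Scope ring_scope.

(* A transformation of [0, 1) is represented by a function T : R -> R whose
   values outside [0, 1) are irrelevant. *)

Definition unit_ico {R : realType} : set R := `[0, 1[.

(* The endpoints 0 = c 0 < c 1 < ... < c d = 1 cut [0, 1) into d pieces. That T
   permutes the pieces, i.e. that their images are again left-closed right-open
   intervals tiling [0, 1), is the combination of the last three clauses. *)
Definition is_iet (R : realType) (T : R -> R) : Prop :=
  exists (d : nat) (c : nat -> R),
    [/\ c 0%N = 0 /\ c d = 1,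
        forall i, (i < d)%N -> c i < c i.+1,
        forall i, (i < d)%N ->
          {in `[c i, c i.+1[ &, forall x y, `|T x - T y| = `|x - y|},
        forall i, (i < d)%N -> {in `[c i, c i.+1[ &, {homo T : x y / x < y}}
      & set_bij unit_ico unit_ico T].

(* Two-sided orbit {T^n x | n in Z}: for T bijective on [0, 1), T^{-n} x is the
   unique y in [0, 1) such that T^n y = x. *)
Definition orbit (R : realType) (T : R -> R) (x : R) : set R :=
  [set y | unit_ico y /\ exists n, iter n T x = y \/ iter n T y = x].

Definition minimal (R : realType) (T : R -> R) : Prop :=
  forall x, unit_ico x -> unit_ico `<=` closure (orbit T x).

(* The points of iter n T @^-1` A lying outside [0, 1) are discarded by the
   intersection with B. *)
Definition mixing_sequence (R : realType) (T : R -> R) (a : nat -> nat) : Prop :=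
  {homo a : m n / (m < n)%N} /\
  forall A B : set R, measurable A -> measurable B ->
    A `<=` unit_ico -> B `<=` unit_ico ->
    lebesgue_measure ((iter (a i) T @^-1` A) `&` B) @[i --> \oo]
      --> (lebesgue_measure A * lebesgue_measure B)%E.

Definition thick (f a : nat -> nat) : Prop :=
  {homo a : m n / (m < n)%N} /\
  infinite_set [set j | [set k | (j <= k <= f j)%N] `<=` range a].

(* Main.v *)
Require Import Defs.
From mathcomp Require Import all_boot all_order all_algebra.
From mathcomp Require Import all_classical all_reals all_analysis measurable_realfun.
From mathcomp Require Import ring lra zify.

(** Let D be the set of discontinuities and put delta = 1 / (3 d + 1). For
    every L, cut [0, 1) at the points reaching D in fewer than L steps. All but
    at most 3 d + 1 of the resulting gaps are mapped by T onto gaps, so the gaps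
    form at most 3 d + 1 Rokhlin towers, one of which has measure at least delta;
    its height h is at most L d, and T^k is a translation on its base I for every
    k <= L. Take L = N^5, with N such that [N, N^N] consists of mixing times.

    If h >= N, the levels are short, and by Kac at least half of I returns to I
    within 2 h / delta <= N^N steps, while these return times take a number of
    values bounded independently of N. If h < N, some T^n with n <= N^2 maps a
    point of I back to I, hence translates I by some t; iterating, T^(l n)
    translates I by l t as long as l n <= L, so |t| <= N^-3 and the single time
    N n moves I by at most N^-2.

    In both cases boundedly many times n in [N, N^N] are such that the sets
    {x : |T^n x - x| <= 1 / M} cover measure delta / 2. Mixing on the cells
    [i / M, (i + 1) / M) bounds each of these sets by 6 / M, which is absurd for
    large M. *)

Set Implicit Arguments.
Unset Strict Implicit.
Unset Printing Implicit Defensive.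
Import Order.TTheory GRing.Theory Num.Theory.
Import numFieldNormedType.Exports.

Local Open Scope classical_set_scope.
Local Open Scope ring_scope.

(** * Translation invariance of Lebesgue measure *)

Section Translation.
Context {R : realType}.
Implicit Types (A : set R) (t : R).
Local Notation mu := (@lebesgue_measure R).

Lemma measurable_translation t :
  measurable_fun setT (fun x : R => x + t : measurableTypeR R).
Proof. exact: measurable_funD. Qed.

Lemma preimage_translation_measurable A t :
  measurable A -> measurable ((fun x => x + t) @^-1` A).
Proof.
move=> mA; rewrite -[X in measurable X]setTI.
exact: measurable_translation.
Qed.

(** The pushforward under a translation agrees with Lebesgue measure on half-open intervals, and
    uniqueness does the rest. *)
Lemma lebesgue_measure_translation A t :
  measurable A -> mu ((fun x => x + t) @^-1` A) = mu A.
Proof.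
move=> mA; have mf := measurable_translation t.
pose f : measurableTypeR R -> measurableTypeR R := fun x => x + t.
rewrite -[LHS]/(pushforward mu f A).
apply/esym/lebesgue_measure_unique => //= _ [[a b]] _ <-.
rewrite /pushforward.
have -> : f @^-1` `]a, b] = `]a - t, b - t]%classic.
  by apply/seteqP; split => x; rewrite /f/= !in_itv/= ltrBlDr lerBrDr.
rewrite !lebesgue_measure_itv/= !lte_fin ltrD2r.
by case: ifP => // _; congr (_%:E); lra.
Qed.

End Translation.

(** * Subadditivity and packing of disjoint sets *)

Section MeasureBounds.
Context (d : measure_display) (X : measurableType d) (R : realType).
Context (mu : {measure set X -> \bar R}).
Local Open Scope ereal_scope.

Lemma measure_bigsetU_le (I : Type) (s : seq I) (F : I -> set X) :
  (forall i, measurable (F i)) ->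
  mu (\big[setU/set0]_(i <- s) F i) <= \sum_(i <- s) mu (F i).
Proof.
move=> mF; elim: s => [|i s IHs]; first by rewrite !big_nil measure0.
rewrite !big_cons; apply: le_trans (measureU2 _ _ _) _ => //.
  exact: bigsetU_measurable.
exact: leeD.
Qed.

Lemma sum_disjoint_le_measure n (F : nat -> set X) (V : set X) :
  measurable V -> (forall k, (k < n)%N -> measurable (F k)) ->
  (forall j k x, (j < k < n)%N -> F j x -> ~ F k x) ->
  (forall k, (k < n)%N -> F k `<=` V) ->
  \sum_(k < n) mu (F k) <= mu V.
Proof.
move=> mV mF disjF FV.
have tF : trivIset `I_n F.
  move=> j k /= jn kn [x [Fj Fk]]; case: (ltngtP j k) => // [jk|kj].
    by have := disjF j k x; rewrite jk kn => /(_ isT Fj Fk).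
  by have := disjF k j x; rewrite kj jn => /(_ isT Fk Fj).
have mU : measurable (\big[setU/set0]_(k < n) F k).
  by apply: bigsetU_measurable => k _; exact: mF.
rewrite -(measure_semi_additive_ord_I mu) //.
apply: le_measure; rewrite ?inE//.
by rewrite -bigcup_mkord; apply: bigcup_sub => k; exact: FV.
Qed.

End MeasureBounds.

(** * The exchanged pieces: translation, measure and measurability *)

Section Pieces.
Context (R : realType) (T : R -> R) (d : nat) (c : nat -> R).
Context (c0 : c 0%N = 0) (cd : c d = 1)
  (c_lt : forall i, (i < d)%N -> c i < c i.+1)
  (T_isom : forall i, (i < d)%N ->
    {in `[c i, c i.+1[ &, forall x y, `|T x - T y| = `|x - y|})
  (T_homo : forall i, (i < d)%N -> {in `[c i, c i.+1[ &, {homo T : x y / x < y}})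
  (T_bij : set_bij unit_ico unit_ico T).
Local Notation mu := (@lebesgue_measure R).

Lemma cut_le i j : (i <= j <= d)%N -> c i <= c j.
Proof.
move=> /andP[ij]; rewrite -(subnKC ij); elim: (j - i)%N => [|k IHk]; first by rewrite addn0.
rewrite addnS => lt_d; apply: le_trans (IHk (ltnW lt_d)) _.
exact/ltW/c_lt.
Qed.

Lemma piece_exists x : 0 <= x < 1 -> exists2 i, (i < d)%N & c i <= x < c i.+1.
Proof.
move=> /andP[x0 x1]; have ex : exists i, x < c i by exists d; rewrite cd.
case: (ex_minnP ex) => -[|i] xi imin; first by rewrite c0 ltNge x0 in xi.
exists i; last by rewrite xi andbT leNgt; apply/negP => /imin; rewrite ltnn.
by rewrite ltnNge; apply/negP => di; have := imin d; rewrite cd x1 leqNgt ltnS di => /(_ isT).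
Qed.

Lemma piece_translation i x : (i < d)%N -> c i <= x < c i.+1 ->
  T x = T (c i) + (x - c i).
Proof.
move=> id xi; have ci : c i \in `[c i, c i.+1[ by rewrite in_itv /= lexx c_lt.
have xin : x \in `[c i, c i.+1[ by rewrite in_itv.
case/andP: xi; rewrite le_eqVlt => /orP[/eqP <-|cx _]; first by rewrite subrr addr0.
have := T_isom id xin ci; rewrite !gtr0_norm ?subr_gt0 //; last exact: (T_homo id ci xin cx).
by move=> <-; rewrite addrC subrK.
Qed.

(** The right end of the piece of [u] would be a cut in (u, v] if [v] lay outside that piece. A cut
    at [u] itself is harmless since pieces are left-closed. *)
Lemma translation_off_cuts u v : 0 <= u -> u <= v -> v < 1 ->
  (forall e, e \in [seq c i | i <- iota 0 d] -> ~~ (u < e <= v)) ->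
  T v = T u + (v - u).
Proof.
move=> u0 uv v1 off; have [|i id /andP[iu ui]] := @piece_exists u.
  by rewrite u0 (le_lt_trans uv).
have vi : v < c i.+1.
  rewrite ltNge; apply/negP => civ.
  have id' : (i.+1 < d)%N.
    rewrite ltn_neqAle id andbT; apply/eqP => e.
    by move: civ; rewrite e cd leNgt v1.
  have /off : c i.+1 \in [seq c i | i <- iota 0 d].
    by apply: map_f; rewrite mem_iota.
  by rewrite ui civ.
rewrite (@piece_translation i u) ?iu// (@piece_translation i v) ?vi ?(le_trans iu)//.
lra.
Qed.

(** Each piece of [A] is translated, hence keeps its measure, and injectivity makes the images of
    the pieces disjoint. The inequality suffices for the packing arguments below. *)
Lemma image_measure_ge (A : set R) : measurable A -> A `<=` unit_ico ->
  measurable (T @` A) /\ (mu A <= mu (T @` A))%E.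
Proof.
move=> mA Au.
pose B i : set R := A `&` `[c i, c i.+1[.
have mB i : measurable (B i) by exact: measurableI.
have TB i : (i < d)%N -> T @` B i = (fun x => x + (c i - T (c i))) @^-1` B i.
  move=> id; apply/seteqP; split => [_ [x [Ax xi] <-]|y [Ay]] /=.
    rewrite /= in_itv /= in xi; rewrite (piece_translation id xi).
    by rewrite (_ : _ + _ = x); [split; rewrite //= in_itv | lra].
  move=> /= yi; exists (y + (c i - T (c i))); first by split.
  by rewrite in_itv /= in yi; rewrite (piece_translation id yi); lra.
have mTB i : (i < d)%N -> measurable (T @` B i).
  by move=> id; rewrite TB //; exact: preimage_translation_measurable.
have AE : A = \big[setU/set0]_(i < d) B i.
  rewrite -bigcup_mkord; apply/seteqP; split => [x Ax|x [i _ []] //].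
  have [|i id xi] := @piece_exists x; first by have := Au _ Ax; rewrite /unit_ico /= in_itv.
  by exists i => //; split => //=; rewrite in_itv.
have mTA : measurable (T @` A).
  rewrite AE -bigcup_mkord image_bigcup bigcup_mkord.
  by apply: bigsetU_measurable => i _; exact: mTB.
split=> //; rewrite {1}AE.
apply: le_trans (measure_bigsetU_le _ _ _) _; first by move=> i; exact: mB.
rewrite (eq_bigr (fun i : 'I_d => mu (T @` B i))); last first.
  by move=> i _; rewrite TB // lebesgue_measure_translation.
apply: (@sum_disjoint_le_measure _ _ R mu d (fun i => T @` B i)) => //; last first.
  by move=> i _ _ [x [Ax _] <-]; exists x.
move=> i j _ /andP[ij jd] [x [Ax xi] <-] [y [Ay yj] Txy].
have [_ Tinj _] := T_bij.
have xy : y = x by apply: Tinj => //; rewrite inE; exact: Au.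
rewrite xy /= in_itv /= in yj; rewrite /= in_itv /= in xi.
have := @cut_le i.+1 j; rewrite ij (ltnW jd) => /(_ isT).
by case/andP: xi => _ /lt_le_trans h /h; case/andP: yj => /le_lt_trans h' _ /h'; rewrite ltxx.
Qed.

Lemma preimage_measurable (A : set R) : measurable A -> A `<=` unit_ico ->
  measurable (unit_ico `&` T @^-1` A).
Proof.
move=> mA Au.
pose B i : set R := `[c i, c i.+1[ `&` (fun x => x + (T (c i) - c i)) @^-1` A.
rewrite (_ : _ `&` _ = \big[setU/set0]_(i < d) B i).
  apply: bigsetU_measurable => i _; apply: measurableI => //.
  exact: preimage_translation_measurable.
rewrite -bigcup_mkord; apply/seteqP; split => x.
  rewrite /unit_ico /= in_itv /= => -[xu Ax]; have [i id xi] := piece_exists xu.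
  exists i => //; split; rewrite /= ?in_itv //=.
  by move: Ax; rewrite (piece_translation id xi); congr (A _); lra.
move=> [i /= id []] /=; rewrite in_itv /= => xi Ax; split; last first.
  by move: Ax; rewrite /= (piece_translation id xi); congr (A _); lra.
rewrite /unit_ico /= in_itv /=; case/andP: xi => ix xi; apply/andP; split.
  by apply: le_trans ix; rewrite -c0; apply: cut_le; lia.
by apply: lt_le_trans xi _; rewrite -cd; apply: cut_le; rewrite id leqnn.
Qed.

End Pieces.

Lemma ltn_addP i j : (i < j)%N -> exists2 k, (0 < k)%N & j = (k + i)%N.
Proof. by move=> ij; exists (j - i)%N; lia. Qed.

Lemma ltn_same_block i k h : (0 < h)%N -> ((i + k) %/ h = k %/ h)%N -> (i < h)%N.
Proof.
move=> h0 e; have := divn_eq (i + k) h; have := divn_eq k h.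
by have := ltn_pmod (i + k) h0; rewrite e; lia.
Qed.

(** Pigeonhole: a maximiser of [F] serves as [x]. *)
Lemma sum_le_size_mul (R : realType) (I : eqType) (s : seq I) (F : I -> R) :
  s != [::] -> exists2 x, x \in s & \sum_(y <- s) F y <= (size s)%:R * F x.
Proof.
elim: s => [//|y [|z s] IHs] _.
  by exists y; rewrite ?mem_seq1// big_seq1 mul1r.
have [//|x xs lex] := IHs; rewrite big_cons.
have [leyx|/ltW lexy] := leP (F y) (F x); [exists x|exists y].
- by rewrite inE xs orbT.
- by rewrite /= -natr1 mulrDl mul1r addrC lerD.
- by rewrite inE eqxx.
- rewrite /= -natr1 mulrDl mul1r addrC lerD// (le_trans lex)//.
  by rewrite ler_wpM2l.
Qed.

(** The right-hand side is the signed length of the intersection of [a, b) with its translate by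
    -u. *)
Lemma le_length_meet_translate (R : realType) (a b u : R) :
  b - a - `|u| <= Num.min b (b - u) - Num.max a (a - u).
Proof. by case: ger0P => u0; [rewrite min_r ?max_l|rewrite min_l ?max_r]; lra. Qed.

(** * Iterates of an aperiodic bijection that is a translation off [D] *)

Section Dynamics.
Context (R : realType) (T S : R -> R) (D : seq R).
Context (T_unit : forall x : R, 0 <= x < 1 -> 0 <= T x < 1)
  (S_unit : forall x : R, 0 <= x < 1 -> 0 <= S x < 1)
  (TK : forall x : R, 0 <= x < 1 -> S (T x) = x)
  (SK : forall x : R, 0 <= x < 1 -> T (S x) = x)
  (D0 : 0 \in D) (D_unit : forall e, e \in D -> 0 <= e < 1)
  (T_off : forall u v : R, 0 <= u -> u <= v -> v < 1 ->
    (forall e, e \in D -> ~~ (u < e <= v)) -> T v = T u + (v - u))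
  (T_aper : forall (x : R) n, 0 <= x < 1 -> (0 < n)%N -> iter n T x <> x).

Lemma iter_unit n x : 0 <= x < 1 -> 0 <= iter n T x < 1.
Proof. by move=> xu; elim: n => //= n; exact: T_unit. Qed.

Lemma iter_inv_unit n x : 0 <= x < 1 -> 0 <= iter n S x < 1.
Proof. by move=> xu; elim: n => //= n; exact: S_unit. Qed.

Lemma iterK n x : 0 <= x < 1 -> iter n S (iter n T x) = x.
Proof.
by move=> xu; elim: n => // n IHn; rewrite iterSr iterS TK ?IHn// iter_unit.
Qed.

Lemma iter_invK n x : 0 <= x < 1 -> iter n T (iter n S x) = x.
Proof.
by move=> xu; elim: n => // n IHn; rewrite iterSr iterS SK ?IHn// iter_inv_unit.
Qed.

Lemma iter_inj n x y : 0 <= x < 1 -> 0 <= y < 1 ->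
  iter n T x = iter n T y -> x = y.
Proof. by move=> xu yu e; rewrite -(iterK n xu) e iterK. Qed.

Lemma iter_aperiodic i j x : 0 <= x < 1 -> iter i T x = iter j T x -> i = j.
Proof.
wlog ij : i j / (i <= j)%N => [hw xu e|xu].
  by case/orP: (leq_total i j) => h; [|apply/esym]; apply: hw.
move=> e; have [k jk] : exists k, j = (i + k)%N by exists (j - i)%N; lia.
move: e; rewrite {}jk iterD => /(iter_inj xu (iter_unit _ xu)) e.
by case: k e => [|k] e; [rewrite addn0|case: (@T_aper x k.+1)].
Qed.

(** Induction on [k]: if [z, y] has been translated so far, a point of [D] in the way of the next
    step would be the image of a point of (z, y], which is excluded. *)
Lemma iter_translation z x m : 0 <= z -> x < 1 ->
  (forall y k, z < y <= x -> (k < m)%N -> iter k T y \notin D) ->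
  forall k y, (k <= m)%N -> z <= y <= x -> iter k T y = iter k T z + (y - z).
Proof.
move=> z0 x1 off; elim=> [|k IHk] y km /andP[zy yx] /=; first by rewrite addrC subrK.
have ey : iter k T y = iter k T z + (y - z) by apply: IHk (ltnW km) _; rewrite zy.
have /andP[kz0 _] : 0 <= iter k T z < 1 by apply: iter_unit; lra.
have /andP[_ ky1] : 0 <= iter k T y < 1 by apply: iter_unit; lra.
rewrite (T_off kz0 _ ky1); [rewrite ey; lra|rewrite ey; lra|].
move=> e eD; apply/negP => /andP[ze ey'].
have e' : e = iter k T (z + (e - iter k T z)).
  by rewrite (IHk _ (ltnW km)); lra.
rewrite ey in ey'; suff: iter k T (z + (e - iter k T z)) \notin D by rewrite -e' eD.
by apply: off km; lra.
Qed.

Lemma translation_no_cross z x k e :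
  (forall y, z <= y <= x -> iter k T y = iter k T z + (y - z)) ->
  (forall y, z < y <= x -> iter k T y <> e) -> z <= x ->
  ~~ (iter k T z < e <= iter k T x).
Proof.
move=> tr ne zx; apply/negP => /andP[ze ex]; rewrite tr in ex; last lra.
by apply: (ne (z + (e - iter k T z))); [lra|rewrite tr; lra].
Qed.

(** * Construction of a large Rokhlin tower *)

Section Tower.
Context (L : nat) (L_gt0 : (0 < L)%N).

Let P := [seq iter k S e | k <- iota 0 L, e <- D].

(** For [a] in [P], the gap starting at [a] is [a, next a); the default 1 closes the last gap. *)
Let next a := \big[Num.min/1]_(p <- P | a < p) p.
Let prev b := \big[Num.max/0]_(p <- P | p < b) p.

Let mem_P x : reflect (0 <= x < 1 /\ exists2 k, (k < L)%N & iter k T x \in D) (x \in P).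
Proof.
apply: (iffP allpairsP) => [[[k e] /= [+ eD ->]]|[xu [k kL kD]]].
  rewrite mem_iota add0n => /andP[_ kL]; have eu := D_unit eD.
  by split; [exact: iter_inv_unit|exists k => //; rewrite iter_invK].
by exists (k, iter k T x); split; rewrite ?mem_iota//= iterK.
Qed.

Let P_unit x : x \in P -> 0 <= x < 1. Proof. by case/mem_P. Qed.

Let D_sub_P x : x \in D -> x \in P.
Proof. by move=> xD; apply/mem_P; split; [exact: D_unit|exists 0%N]. Qed.

Let size_P : size P = (L * size D)%N.
Proof. by rewrite size_allpairs size_iota. Qed.

Let next_le1 a : next a <= 1. Proof. exact: bigmin_le_id. Qed.

Let next_le a p : p \in P -> a < p -> next a <= p.
Proof. by move=> pP ap; apply: ge_bigmin_seq. Qed.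

Let next_mem a : next a = 1 \/ next a \in P.
Proof.
rewrite /next big_seq_cond; apply: (big_ind (fun x => x = 1 \/ x \in P)).
- by left.
- by move=> x y; rewrite minEle; case: ifP.
- by move=> p /andP[]; right.
Qed.

Let lt_next a : a < 1 -> a < next a.
Proof.
move=> a1; apply: (big_ind (fun x => a < x)) => // x y ax ay.
by rewrite lt_min ax.
Qed.

Let next_eq a b : a < b -> b <= 1 -> b = 1 \/ b \in P ->
  (forall p, p \in P -> a < p -> b <= p) -> next a = b.
Proof.
move=> ab b1 bP bmin; apply/eqP; rewrite eq_le; apply/andP; split.
  by case: bP => [->|bP]; [exact: next_le1|exact: next_le].
by case: (next_mem a) => [->//|nP]; apply: bmin => //; apply: lt_next; lra.
Qed.

Let prev_eq a b : a \in P -> a < b -> (forall p, p \in P -> p < b -> p <= a) ->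
  prev b = a.
Proof.
move=> aP ab amax; apply/eqP; rewrite eq_le; apply/andP; split; last exact: le_bigmax_seq.
rewrite /prev big_seq_cond; apply: (big_ind (fun x => x <= a)).
- by case/andP: (P_unit aP).
- by move=> x y xa ya; rewrite ge_max xa.
- by move=> p /andP[]; exact: amax.
Qed.

Let no_P_in_gap a p : p \in P -> a < p -> p < next a -> False.
Proof. by move=> pP ap; rewrite ltNge next_le. Qed.

Let gap_prev a b : a \in P -> a < b -> b <= next a -> prev b = a.
Proof.
move=> aP ab bn; apply: prev_eq => // p pP pb; rewrite leNgt; apply/negP => ap.
exact: (no_P_in_gap pP ap (lt_le_trans pb bn)).
Qed.

Let gap_off a y k : a < y < next a -> 0 <= a -> (k < L)%N -> iter k T y \notin D.
Proof.
move=> /andP[ay yn] a0 kL; apply/negP => yD; apply: (@no_P_in_gap a y) => //.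
apply/mem_P; split; last by exists k.
by have := next_le1 a; lra.
Qed.

Let gap_translation a y : a \in P -> a <= y < next a -> T y = T a + (y - a).
Proof.
move=> /P_unit /andP[a0 a1] /andP[ay yn].
have n1 := next_le1 a; apply: T_off => //; first lra.
move=> e eD; apply/negP => /andP[ae ey].
by apply: (@no_P_in_gap a e); [exact: D_sub_P| |lra].
Qed.

(* A gap [a, next a) whose left endpoint is outside W is mapped onto a gap: it
   can fail to be only if an endpoint is a discontinuity, or if a point of
   S^L D lies inside. *)
Let W := D ++ [seq prev b | b <- 1 :: D ++ [seq iter L S e | e <- D]].

(** Outside [D], a step of [T] keeps a point in [P], since one step fewer remains before [D]. A
    point of [P] strictly inside the image gap would have a preimage inside the gap reaching [D] in
    at most [L] steps: it would lie in [P], or be [iter L S e] for some [e] in [D], and both are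
    excluded. *)
Let gap_step a : a \in P -> a \notin W ->
  T a \in P /\ next (T a) = T a + (next a - a).
Proof.
move=> aP; rewrite mem_cat negb_or => /andP[aD /mapP aprev].
have /andP[a0 a1] := P_unit aP; have n1 := next_le1 a; have an := lt_next a1.
have shift x : 0 <= x < 1 -> x \notin D -> x \in P -> T x \in P.
  move=> xu xD /mem_P[_ [[|k] kL kD]]; first by rewrite (negbTE xD) in kD.
  by apply/mem_P; split; [exact: T_unit|exists k; [exact: ltnW|rewrite -iterSr]].
have bad b : b \in 1 :: D ++ [seq iter L S e | e <- D] -> a < b -> b <= next a -> False.
  by move=> bW ab bn; apply: aprev; exists b => //; rewrite (gap_prev aP).
have TaP : T a \in P := shift _ (P_unit aP) aD aP.
split=> //; case: (next_mem a) => [n_1|nP].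
  by case: (@bad 1); rewrite ?mem_head ?n_1.
have nD : next a \notin D.
  by apply/negP => nD; apply: (@bad (next a)); rewrite // inE mem_cat nD orbT.
have nu := P_unit nP.
have Tn : T (next a) = T a + (next a - a).
  apply: T_off; [by []|exact: ltW|by case/andP: nu|] => e eD; apply/negP.
  move=> /andP[ae]; rewrite le_eqVlt => /orP[/eqP en|en].
    by rewrite -en eD in nD.
  by apply: (@no_P_in_gap a e) => //; exact: D_sub_P.
have TnP := shift _ nu nD nP.
rewrite -Tn; apply: next_eq; [rewrite Tn; lra| |by right|].
  by apply/ltW; case/andP: (P_unit TnP).
move=> p pP Tap; rewrite leNgt; apply/negP => pTn.
pose y := a + (p - T a); have Ty : T y = p.
  by rewrite (gap_translation (y := y) aP) /y; [lra|rewrite Tn in pTn; lra].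
have [ay yn] : a < y /\ y < next a by rewrite /y; rewrite Tn in pTn; split; lra.
have yu : 0 <= y < 1 by lra.
case/mem_P: pP => _ [k kL]; rewrite -Ty -iterSr => kD.
case: (ltnP k.+1 L) => [kL'|Lk].
  by apply: (@no_P_in_gap a y) => //; apply/mem_P; split => //; exists k.+1.
have {kL Lk} kL : k.+1 = L by apply/eqP; rewrite eqn_leq kL Lk.
apply: (@bad y) => //; last exact: ltW.
rewrite inE mem_cat; apply/orP; right; apply/orP; right.
by apply/mapP; exists (iter k.+1 T y) => //; rewrite kL iterK.
Qed.

Let chain a j : a \in P -> (forall i, (i < j)%N -> iter i T a \notin W) ->
  forall i, (i <= j)%N ->
  iter i T a \in P /\ next (iter i T a) = iter i T a + (next a - a).
Proof.
move=> aP off; elim=> [_|i IHi ij]; first by split=> //=; rewrite addrC subrK.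
have [iP ni] := IHi (ltnW ij); have [iP' ni'] := gap_step iP (off i ij).
by split=> //=; rewrite ni' ni; lra.
Qed.

(** Otherwise the orbit of [a] would consist of infinitely many distinct points of the finite set
    [P]. *)
Let hit a : a \in P -> exists j, iter j T a \in W /\
  forall i, (i < j)%N -> iter i T a \notin W.
Proof.
move=> aP; have ex : exists j, iter j T a \in W.
  apply: contrapT => /forallNP nW.
  have inP i : iter i T a \in P.
    by apply: (proj1 (chain (j := i) aP _ _)) => // k _; apply/negP; exact: nW.
  have := @uniq_leq_size _ [seq iter i T a | i <- iota 0 (size P).+1] P.
  rewrite size_map size_iota ltnn => h; suff: false by []. apply: h.
    rewrite map_inj_in_uniq ?iota_uniq// => i j _ _.
    by apply: iter_aperiodic; exact: P_unit.
  by move=> _ /mapP[i _ ->].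
case: (ex_minnP ex) => j jW jmin; exists j; split=> // i ij.
by apply/negP => /jmin; rewrite leqNgt ij.
Qed.

Let cover x : 0 <= x < 1 -> exists2 a, a \in P & a <= x < next a.
Proof.
move=> /andP[x0 x1]; pose l := \big[Num.max/0]_(p <- P | p <= x) p.
have lP : l \in P /\ l <= x.
  rewrite /l big_seq_cond; apply: (big_ind (fun l => l \in P /\ l <= x)).
  - by split=> //; exact: D_sub_P.
  - by move=> u v ? ?; rewrite maxEle; case: ifP.
  - by move=> p /andP[].
exists l; first exact: lP.1.
rewrite lP.2 /=; case: (next_mem l) => [->//|nP].
rewrite ltNge; apply/negP => nx.
have : next l <= l by move: (next l) nP nx => p pP px; exact: le_bigmax_seq.
by rewrite leNgt lt_next// (le_lt_trans lP.2).
Qed.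

Let sum_gaps : 1 <= \sum_(a <- undup P) (next a - a).
Proof.
have mgap a : measurable (`[a, next a[%classic : set R) by [].
have := measure_bigsetU_le (@lebesgue_measure R) (undup P) mgap.
have -> : (\sum_(a <- undup P) lebesgue_measure `[a, next a[%classic =
    (\sum_(a <- undup P) (next a - a))%:E)%E.
  rewrite -sumEFin big_seq [RHS]big_seq; apply: eq_bigr => a.
  rewrite mem_undup => /P_unit/andP[_ a1].
  by rewrite lebesgue_measure_itv/= lte_fin lt_next.
rewrite -lee_fin; apply: le_trans.
have <- : lebesgue_measure (`[0, 1[%classic : set R) = 1%:E.
  by rewrite lebesgue_measure_itv/= lte_fin ltr01 -EFinB subr0.
apply: le_measure; rewrite ?inE//.
  by apply: bigsetU_measurable => a _; exact: mgap.
move=> x; rewrite /= in_itv /= => /cover[a aP xa].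
rewrite -bigcup_seq; exists a; first by rewrite /= mem_undup.
by rewrite /= in_itv.
Qed.

(** Gaps are grouped by the point of [W] at which their chain first stops. Lengths are constant
    along chains, so a group consists of gaps of equal length, and by pigeonhole some group has
    total length at least 1 / |W|. Its size becomes the height [h], and its member with a late
    enough exit becomes the base. *)
Lemma tower_exists : exists a b h,
  [/\ 0 <= a < b /\ b <= 1,
      forall y k, a < y < b -> (k < L)%N -> iter k T y \notin D,
      forall y k, a <= y < b -> (k < h)%N -> iter k T y = iter k T a + (y - a),
      forall y k, a <= y < b -> (0 < k < h)%N -> ~~ (a <= iter k T y < b)
    & (0 < h <= L * size D)%N /\ 1 <= (3 * size D).+1%:R * h%:R * (b - a)].
Proof.
have /choice[j hj] : forall a, exists j, a \in P -> iter j T a \in W /\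
  forall i, (i < j)%N -> iter i T a \notin W.
  by move=> a; case: (boolP (a \in P)) => [/hit[j ?]|]; [exists j|exists 0%N].
pose phi a := iter (j a) T a; pose len a := next a - a.
have len_gt0 a : a \in P -> 0 < len a.
  by move=> /P_unit/andP[_ /lt_next]; rewrite subr_gt0.
have len_phi a : a \in P -> len (phi a) = len a.
  move=> aP; have [_ off] := hj _ aP.
  by have [_ e] := chain aP off (leqnn _); rewrite /len /phi e; lra.
pose F w := \sum_(a <- undup P | phi a == w) len a.
have sumF : 1 <= \sum_(w <- W) F w.
  apply: le_trans sum_gaps _; rewrite /F (exchange_big_dep xpredT)//=.
  rewrite big_seq [leRHS]big_seq; apply: ler_sum => a; rewrite mem_undup => aP.
  have [phiW _] := hj _ aP; rewrite (big_rem _ phiW)/= eqxx lerDl.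
  by apply: sumr_ge0 => w _; apply/ltW/len_gt0.
have [|w wW sumF'] := @sum_le_size_mul R _ W F.
  by rewrite /W; case: (D) D0.
have {sumF'} := le_trans sumF sumF'.
pose A := [seq a <- undup P | phi a == w].
have AP a : a \in A -> a \in P /\ phi a = w.
  by rewrite mem_filter mem_undup => /andP[/eqP].
have -> : F w = (size A)%:R * len w.
  rewrite /F -big_filter -/A big_seq (eq_bigr (fun=> len w)).
    by rewrite -big_seq big_const_seq count_predT iter_addr addr0 mulr_natl.
  by move=> a /AP[/len_phi <- ->].
have -> : size W = (3 * size D).+1.
  by rewrite /W size_cat size_map /= size_cat size_map; lia.
move=> sum1.
have A0 : (0 < size A)%N.
  by rewrite lt0n; apply/eqP => A0; move: sum1; rewrite A0 mul0r mulr0 ler10.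
have A_uniq : uniq A by rewrite filter_uniq// undup_uniq.
(* All members of [A] exit at the same point [w], so by injectivity their exit times are distinct
   and cannot all lie below |A| - 1. *)
have [a aA ja] : exists2 a, a \in A & ((size A).-1 <= j a)%N.
  apply: contrapT => nA.
  have := @uniq_leq_size _ [seq j a | a <- A] (iota 0 (size A).-1).
  rewrite size_map size_iota -ltnS prednK// ltnn => h; suff: false by []. apply: h.
    rewrite map_inj_in_uniq// => x y /AP[xP px] /AP[yP py] jxy.
    by apply: (@iter_inj (j x)); rewrite ?P_unit// {2}jxy; rewrite /phi in px py; rewrite px py.
  move=> _ /mapP[x xA ->]; rewrite mem_iota /= add0n ltnNge; apply/negP => xj.
  by apply: nA; exists x.
have [aP aw] := AP _ aA; have [_ off] := hj _ aP.
have /andP[a0 a1] := P_unit aP; have ch := chain aP off.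
have n1 := next_le1 a.
have le_j k : (k < size A)%N -> (k <= j a)%N.
  by move=> kA; apply: leq_trans ja; rewrite -ltnS prednK.
have levels y k : a <= y < next a -> (k < size A)%N ->
    iter k T y = iter k T a + (y - a).
  move=> yI; elim: k => [_|k IHk kA] /=; first by rewrite addrC subrK.
  have [kP kn] := ch k (le_j _ (ltnW kA)).
  by rewrite IHk 1?ltnW// (gap_translation kP) ?kn; lra.
exists a, (next a), (size A); split=> //.
- by rewrite a0 lt_next.
- by move=> y k yI; exact: gap_off yI a0.
- move=> y k yI /andP[k0 kA]; apply/negP => yI'; have [kP kn] := ch k (le_j _ kA).
  have ek := levels y k yI kA; rewrite ek in yI'.
  (* Both intervals are gaps, so if they meet they have the same left endpoint; aperiodicity then
     forces [k] to be 0. *)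
  have: iter k T a = iter 0 T a.
    rewrite /=; case: (ltgtP (iter k T a) a) => // h; exfalso.
      by apply: (@no_P_in_gap (iter k T a) a) => //; rewrite kn; lra.
    by apply: (@no_P_in_gap a (iter k T a)) => //; lra.
  by move/iter_aperiodic => e; rewrite e ?P_unit in k0.
- split; first by rewrite A0 -size_P -(size_map id) map_id uniq_leq_size// => x /AP[].
  by rewrite -mulrA -/(len a) -(len_phi _ aP) aw.
Qed.

End Tower.

(* The first return time to [a, b) can only change at a point that reaches an
   endpoint or a discontinuity; since returns take time at least h, each of
   these targets produces at most one such point per block of h times. *)
Lemma return_times a b h w : 0 <= a -> b <= 1 -> (0 < h)%N ->
  (forall y k, a <= y < b -> (0 < k < h)%N -> ~~ (a <= iter k T y < b)) ->
  exists s : seq nat,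
  [/\ (size s <= ((size D).+2 * (2 * w).+1).+1)%N,
      forall n, n \in s -> (h <= n <= 2 * w * h)%N
    & forall x n, a <= x < b -> (0 < n <= 2 * w * h)%N -> a <= iter n T x < b ->
      exists2 m, m \in s & a <= iter m T x < b].
Proof.
move=> a0 b1 h0 free; set r := (2 * w * h)%N.
(* [g (e, q)] is the only point of [a, b) that can reach [e] at a time in the [q]-th block: of two
   such points, one would be mapped to the other in fewer than [h] steps, against [free]. *)
have /choice[g gP] : forall eq : R * nat, exists y, forall k, (k %/ h = eq.2)%N ->
    0 <= eq.1 < 1 -> a <= iter k S eq.1 < b -> iter k S eq.1 = y.
  move=> [e q] /=.
  have [[k [kq kI]]|nex] := pselect (exists k, (k %/ h = q)%N /\ a <= iter k S e < b); last first.
    by exists 0 => k kq _ kI; exfalso; apply: nex; exists k.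
  exists (iter k S e) => l lq eu lI.
  wlog kl : k l kq kI lq lI / (k < l)%N => [hw|].
    by case: (ltngtP k l) => [kl|lk|-> //]; [|apply/esym]; apply: hw.
  have [i i0 li] := ltn_addP kl.
  have ih : (i < h)%N by apply: (@ltn_same_block i k) => //; rewrite -li lq kq.
  have := free _ i lI; rewrite i0 ih li iterD iter_invK; last exact: iter_inv_unit.
  by rewrite kI => /(_ isT).
have /choice[t tP] : forall z, exists n, forall m, (0 < m <= r)%N ->
    a <= iter m T z < b -> (0 < n <= r)%N /\ a <= iter n T z < b.
  move=> z; have [[n nP]|nex] := pselect (exists n, (0 < n <= r)%N /\ a <= iter n T z < b).
    by exists n.
  by exists 0%N => m mr mI; exfalso; apply: nex; exists m.
pose E := a :: b :: D.
(* Times up to r = 2 w h, that bound included, lie in the blocks 0, ..., 2 w. *)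
pose Y := [seq g (e, q) | e <- E, q <- iota 0 (2 * w).+1]; pose Z := a :: Y.
have size_Y : size Y = ((size D).+2 * (2 * w).+1)%N.
  by rewrite size_allpairs size_iota.
exists [seq n <- [seq t z | z <- Z] | (h <= n <= r)%N]; split.
- rewrite size_filter; apply: leq_trans (count_size _ _) _.
  by rewrite size_map -size_Y leqnn.
- by move=> n; rewrite mem_filter => /andP[].
(* No point of (z, x] reaches [a], [b] or [D] within [r] steps, so [x] and [z] are in [a, b) at the
   same times; the time chosen for [z] then works for [x]. *)
move=> x n xI nr nI; pose z := \big[Num.max/a]_(y <- Z | y <= x) y.
have az : a <= z by exact: bigmax_ge_id.
have [zZ zx] : z \in Z /\ z <= x.
  rewrite /z big_seq_cond; apply: (big_ind (fun l => l \in Z /\ l <= x)).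
  - by rewrite mem_head; case/andP: xI.
  - by move=> u v ? ?; rewrite maxEle; case: ifP.
  - by move=> p /andP[].
have off y k e : z < y <= x -> (k <= r)%N -> 0 <= y < 1 -> e \in E -> iter k T y <> e.
  move=> /andP[zy yx] kr yu eE ye; have : y <= z; last by rewrite leNgt zy.
  rewrite /z; apply: le_bigmax_seq => //; rewrite inE; apply/orP; right.
  apply/allpairsP; exists (e, k %/ h)%N; split=> //.
    by rewrite mem_iota add0n leq0n ltnS -(mulnK (2 * w) h0) leq_div2r.
  rewrite -(gP (e, k %/ h)%N k) /= -?ye ?iterK ?iter_unit//; lra.
have yu y : z < y <= x -> 0 <= y < 1 by lra.
have tr k y : (k <= r)%N -> z <= y <= x -> iter k T y = iter k T z + (y - z).
  move=> kr; apply: iter_translation kr; [lra|lra|] => u i uI ir.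
  apply/negP => uD; apply: (off u i (iter i T u)) => //; [exact: ltnW|exact: yu|].
  by rewrite !inE uD !orbT.
have noX k e : (k <= r)%N -> e \in E -> ~~ (iter k T z < e <= iter k T x).
  move=> kr eE; apply: translation_no_cross zx => y yI; first exact: tr.
  by apply: off => //; exact: yu.
have [nr0 nr1] := andP nr.
have nz : a <= iter n T z < b.
  have := noX n a nr1 (mem_head _ _); rewrite (tr n x) ?lexx ?zx// in nI *; lra.
have [tr1 tI] := tP z n nr nz.
have [tr1' tr2] := andP tr1.
exists (t z).
  rewrite mem_filter map_f// tr2 !andbT leqNgt; apply/negP => tzh.
  have zI : a <= z < b by lra.
  by have := free z (t z) zI; rewrite tI tr1' tzh => /(_ isT).
have := noX (t z) b tr2; rewrite !inE eqxx orbT => /(_ isT).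
rewrite (tr (t z) x) ?lexx ?zx//; lra.
Qed.

(** * Measure of images and packing of return-free sets *)

Context (T_image : forall A : set R, measurable A -> A `<=` unit_ico ->
    measurable (T @` A) /\ (lebesgue_measure A <= lebesgue_measure (T @` A))%E)
  (T_preimage : forall A : set R, measurable A -> A `<=` unit_ico ->
    measurable (unit_ico `&` T @^-1` A)).
Local Notation mu := (@lebesgue_measure R).

Lemma iter_image n (A : set R) : measurable A -> A `<=` unit_ico ->
  [/\ measurable (iter n T @` A), iter n T @` A `<=` unit_ico &
      (mu A <= mu (iter n T @` A))%E].
Proof.
move=> mA Au; elim: n => [|n [mn un le_n]]; first by rewrite image_id.
have -> : iter n.+1 T @` A = T @` (iter n T @` A) by rewrite image_comp.
have [mT leT] := T_image mn un; split=> //; last exact: le_trans leT.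
move=> _ [y /un + <-]; rewrite /unit_ico /= !in_itv /=; exact: T_unit.
Qed.

Lemma iter_preimage n (A : set R) : measurable A -> A `<=` unit_ico ->
  measurable (unit_ico `&` iter n T @^-1` A).
Proof.
move=> mA Au; elim: n => [|n IHn]; first exact: measurableI (measurable_itv _) mA.
rewrite (_ : _ `&` _ = unit_ico `&` T @^-1` (unit_ico `&` iter n T @^-1` A)).
  by apply: T_preimage => // x [].
apply/seteqP; split => x; rewrite /unit_ico /= !in_itv /= -iterSr /=.
  by move=> [xu Ax]; split=> //; split=> //; exact: T_unit.
by move=> [xu [_ Ax]].
Qed.

(** The first [m] images of [U] are disjoint, since by injectivity a common point of two of them
    yields an early return to [U]; none has smaller measure than [U], and all lie in [V]. *)
Lemma return_free_measure m (U V : set R) :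
  measurable U -> U `<=` unit_ico -> measurable V ->
  (forall x k, U x -> (k < m)%N -> V (iter k T x)) ->
  (forall x k, U x -> (0 < k < m)%N -> ~ U (iter k T x)) ->
  (m%:R%:E * mu U <= mu V)%E.
Proof.
move=> mU Uu mV UV free.
have -> : (m%:R%:E * mu U = \sum_(k < m) mu U)%E.
  elim: (m) => [|n IHn]; first by rewrite big_ord0 mul0e.
  by rewrite big_ord_recr /= -IHn -natr1 EFinD ge0_muleDl ?mul1e ?lee_fin.
apply: (@le_trans _ _ (\sum_(k < m) mu (iter k T @` U))%E).
  by apply: lee_sum => k _; have [] := iter_image k mU Uu.
apply: (@sum_disjoint_le_measure _ _ R mu m (fun k => iter k T @` U)) => //.
- by move=> k _; have [] := iter_image k mU Uu.
- move=> j k _ /andP[jk km] [x Ux <-] [y Uy e].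
  have xu : 0 <= x < 1 by have := Uu _ Ux; rewrite /unit_ico /= in_itv.
  have yu : 0 <= y < 1 by have := Uu _ Uy; rewrite /unit_ico /= in_itv.
  have [i i0 ki] := ltn_addP jk.
  move: e; rewrite ki addnC iterD => /(iter_inj (iter_unit _ yu) xu) e.
  by apply: (free y i) => //; [rewrite i0; apply: leq_ltn_trans km; rewrite ki leq_addr|rewrite e].
- by move=> k km _ [x Ux <-]; exact: UV.
Qed.

(** * Times at which a tower is moved only slightly *)

Section InTower.
Context (a b : R) (h w : nat) (a0 : 0 <= a) (ab : a < b) (b1 : b <= 1)
  (h_gt0 : (0 < h)%N)
  (levels : forall y k, a <= y < b -> (k < h)%N ->
     iter k T y = iter k T a + (y - a))
  (free : forall y k, a <= y < b -> (0 < k < h)%N -> ~~ (a <= iter k T y < b))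
  (tower_ge : 1 <= w%:R * h%:R * (b - a)).

Let base : set R := `[a, b[%classic.

Let baseE x : base x <-> a <= x < b. Proof. by rewrite /base /= in_itv. Qed.

Let base_unit x : a <= x < b -> 0 <= x < 1.
Proof. by move: a0 b1 => ? ? xI; lra. Qed.

Let base_sub_unit : base `<=` unit_ico.
Proof. by move=> x /baseE xI; rewrite /unit_ico /= in_itv; exact: base_unit. Qed.

Let measurable_base : measurable base. Proof. exact: measurable_itv. Qed.

Let measurable_unit : measurable (unit_ico : set R).
Proof. exact: measurable_itv. Qed.

Let measure_base : mu base = (b - a)%:E.
Proof. by rewrite lebesgue_measure_itv /= lte_fin ab. Qed.

Let measure_unit : mu unit_ico = 1%:E.
Proof. by rewrite lebesgue_measure_itv /= lte_fin ltr01 -EFinB subr0. Qed.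

Let iter_in_unit x k : a <= x < b -> (unit_ico : set R) (iter k T x).
Proof. by move=> xI; rewrite /unit_ico /= in_itv; apply/iter_unit/base_unit. Qed.

Lemma tower_measure_le1 : h%:R * (b - a) <= 1.
Proof.
rewrite -lee_fin EFinM -measure_base -measure_unit.
apply: return_free_measure => //.
  by move=> x k /baseE xI _; exact: iter_in_unit.
by move=> x k /baseE xI kh /baseE; apply/negP; exact: free.
Qed.

(** If [iter n T] brings [x] back to the base, it moves every [iter k T x] with k < h by the same
    amount, because [iter k T] translates the base and commutes with it. So [V] contains [h]
    disjoint copies of [G]. *)
Lemma near_identity_tower (G V : set R) (s : seq nat) (e : R) :
  measurable G -> G `<=` base -> (((b - a) / 2)%:E <= mu G)%E ->
  (forall x, G x -> exists2 n, n \in s & a <= iter n T x < b /\ `|iter n T x - x| <= e) ->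
  measurable V ->
  (forall x n, 0 <= x < 1 -> n \in s -> `|iter n T x - x| <= e -> V x) ->
  ((2 * w)%:R^-1%:E <= mu V)%E.
Proof.
move=> mG Gbase leG near_id mV VP.
have w0 : 0 < w%:R :> R.
  by rewrite ltr0n lt0n; apply/eqP => w0; move: tower_ge; rewrite w0 !mul0r ler10.
apply: (@le_trans _ _ (h%:R%:E * mu G)%E).
  apply: (@le_trans _ _ (h%:R%:E * ((b - a) / 2)%:E)%E); last first.
    by rewrite lee_pmul2l// lte_fin ltr0n.
  rewrite -EFinM lee_fin -div1r natrM ler_pdivrMr ?mulr_gt0//.
  by move: tower_ge; lra.
apply: return_free_measure => //.
- by move=> x /Gbase/base_sub_unit.
- move=> x k Gx kh; have /baseE xI := Gbase _ Gx; have [n ns [nI len]] := near_id _ Gx.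
  apply: (VP _ n) => //; first exact/iter_unit/base_unit.
  rewrite -iterD addnC iterD levels// (levels xI kh).
  by rewrite (_ : _ - _ = iter n T x - x)//; lra.
- move=> x k /Gbase/baseE xI kh /Gbase/baseE; apply/negP; exact: free.
Qed.

Let returning : set R := [set x | a <= x < b /\
  exists2 n, (0 < n <= 2 * w * h)%N & a <= iter n T x < b].

Let returning_sub_base : returning `<=` base.
Proof. by move=> x [/baseE]. Qed.

Let measurable_returning : measurable returning.
Proof.
rewrite (_ : returning = base `&` \bigcup_(n in [set n | (0 < n <= 2 * w * h)%N])
  (unit_ico `&` iter n T @^-1` base)).
  apply: measurableI => //; apply: bigcup_measurable => n _.
  exact: iter_preimage.
apply/seteqP; split=> x.
  move=> [xI [n nr nI]]; split; first exact/baseE.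
  by exists n => //; split; [exact/base_sub_unit/baseE|exact/baseE].
by move=> [/baseE xI [n nr [_ /baseE nI]]]; split=> //; exists n.
Qed.

(** With r = 2 w h, the non-returning part has r + 1 disjoint images, hence measure at most 1 / (r +
    1). As [tower_ge] gives r (b - a) >= 2, this is less than half of the base. *)
Lemma measure_returning : (((b - a) / 2)%:E <= mu returning)%E.
Proof.
set r := (2 * w * h)%N.
have mB : measurable (base `\` returning) by exact: measurableD.
have leB : (r.+1%:R%:E * mu (base `\` returning) <= 1%:E)%E.
  rewrite -measure_unit; apply: return_free_measure => //.
  - by move=> x [/base_sub_unit].
  - by move=> x k [/baseE xI _] _; exact: iter_in_unit.
  - move=> x k [/baseE xI nret] kr [/baseE kI _]; apply: nret; split=> //.
    by exists k.
have : (mu base = mu (base `\` returning) + mu returning)%E.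
  rewrite -[X in (_ + mu X)%E](setIidl returning_sub_base) setIC.
  exact: (measureDI mu).
rewrite measure_base.
have lefin : (mu (base `\` returning) <= (b - a)%:E)%E.
  by rewrite -measure_base; apply: le_measure; rewrite ?inE// => x [].
have lefin' : (mu returning <= (b - a)%:E)%E.
  by rewrite -measure_base; apply: le_measure; rewrite ?inE.
have fB : mu (base `\` returning) \is a fin_num.
  by rewrite ge0_fin_numE// (le_lt_trans lefin) ?ltry.
have fG : mu returning \is a fin_num.
  by rewrite ge0_fin_numE// (le_lt_trans lefin') ?ltry.
move: leB; rewrite -(fineK fB) -(fineK fG) -EFinD -EFinM !lee_fin => leB [e].
have : 2 <= r%:R * (b - a) by move: tower_ge; rewrite /r !natrM; lra.
have r0 : 0 <= r%:R :> R := ler0n _ r.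
move: (fine (mu returning)) (fine (mu (base `\` returning))) leB e => z y.
rewrite -natr1 mulrDl mul1r => leB e two.
have {}leB : r%:R * y <= 1 - y by lra.
rewrite leNgt; apply/negP => zy; have := ab; rewrite -subr_gt0 => ba.
have : r%:R * (b - a) <= r%:R * (2 * y) by rewrite ler_wpM2l//; lra.
lra.
Qed.

Lemma return_exists : exists x n,
  [/\ a <= x < b, (0 < n <= 2 * w * h)%N & a <= iter n T x < b].
Proof.
have [e|/set0P[x [xI [n nr nI]]]] := eqVneq returning set0; last by exists x, n.
by have := measure_returning; rewrite e measure0 lee_fin; move: ab => ab'; lra.
Qed.

(** The base is no longer than 1 / h <= 1 / M, so any return to it is a motion by at most 1 / M. *)
Lemma tall_tower N M : (0 < M <= N)%N -> (N <= h)%N ->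
  exists s : seq nat,
  [/\ (size s <= ((size D).+2 * (2 * w).+1).+1)%N,
      forall n, n \in s -> (N <= n <= 2 * w * h)%N
    & forall V, measurable V ->
      (forall x n, 0 <= x < 1 -> n \in s -> `|iter n T x - x| <= M%:R^-1 -> V x) ->
      ((2 * w)%:R^-1%:E <= mu V)%E].
Proof.
move=> /andP[M0 MN] Nh; have [s [size_s sR ret]] := return_times w a0 b1 h_gt0 free.
exists s; split=> // [n /sR/andP[hn nr]|V mV VP].
  by rewrite nr (leq_trans Nh).
have small : b - a <= M%:R^-1.
  rewrite -[leRHS]div1r ler_pdivlMr ?ltr0n// mulrC.
  apply: le_trans tower_measure_le1; rewrite ler_wpM2r ?subr_ge0 ?(ltW ab)//.
  by rewrite ler_nat (leq_trans MN).
apply: (near_identity_tower measurable_returning returning_sub_base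
  measure_returning _ mV VP) => x [xI [n nr nI]].
have [m ms mI] := ret x n xI nr nI; exists m => //; split=> //.
by apply: le_trans small; rewrite ler_norml; lra.
Qed.

(* Here T^n translates the whole base by t, again and again for as long as
   N ^ 5 steps, so that t is tiny and a multiple of n serves as return time. *)
Lemma short_tower N M : (0 < M <= N)%N -> (2 * w <= N)%N -> (h < N)%N ->
  (forall y k, a < y < b -> (k < N ^ 5)%N -> iter k T y \notin D) ->
  exists m : nat,
  (N <= m <= N ^ 3)%N /\
  forall V, measurable V ->
      (forall x n, 0 <= x < 1 -> n \in [:: m] -> `|iter n T x - x| <= M%:R^-1 -> V x) ->
      ((2 * w)%:R^-1%:E <= mu V)%E.
Proof.
move=> /andP[M0 MN] wN hN off; have [x [n [xI /andP[n0 nr] nI]]] := return_exists.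
have N0 : (0 < N)%N by exact: leq_trans M0 MN.
have nN : (n <= N ^ 2)%N.
  by apply: (leq_trans nr); rewrite -mulnn leq_mul// ltnW.
set t := iter n T x - x.
have tr k y : (k <= N ^ 5)%N -> a <= y < b -> iter k T y = iter k T a + (y - a).
  move=> kN yI; apply: (iter_translation (x := y) a0 _ _ kN); [move: b1; lra| |lra].
  by move=> u i uI iN; apply: off => //; lra.
have tr_mul l y : (l * n <= N ^ 5)%N -> a <= y < b -> iter (l * n) T y = y + l%:R * t.
  elim: l y => [|l IHl] y ln yI; first by rewrite mul0r addr0.
  have ln' : (l * n <= N ^ 5)%N by apply: leq_trans ln; rewrite leq_mul2r leqnSn orbT.
  have : iter (l.+1 * n) T x = x + l.+1%:R * t.
    by rewrite mulSn addnC iterD IHl// -natr1 /t; lra.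
  by rewrite (tr _ x ln xI) (tr _ y ln yI); lra.
have N3n : (N ^ 3 * n <= N ^ 5)%N by rewrite (expnD N 3 2) leq_mul2l nN orbT.
have Nn : (N * n <= N ^ 5)%N.
  by apply: leq_trans N3n; rewrite leq_mul2r -{1}(expn1 N) leq_pexp2l// orbT.
have aI : a <= a < b by rewrite lexx ab.
(* After N^3 n steps [a] has moved by N^3 t without leaving [0, 1). *)
have N2t : N%:R ^+ 2 * `|N%:R * t| <= 1.
  have := iter_unit (N ^ 3 * n) (base_unit aI); rewrite tr_mul//.
  rewrite -[X in X * `|_|]ger0_norm ?exprn_ge0// -normrM mulrA -exprSr -natrX.
  by have := base_unit aI; rewrite ler_norml; lra.
have wR : (2 * w)%:R <= N%:R :> R by rewrite ler_nat.
have hR : h%:R <= N%:R :> R by rewrite ler_nat ltnW.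
have ba0 : 0 < b - a by rewrite subr_gt0.
have N2R : (0 : R) < N%:R ^+ 2 by rewrite exprn_gt0// ltr0n.
set u := N%:R * t in N2t *.
(* From [tower_ge], 2 w <= N and h <= N it follows that N^2 (b - a) >= 2. *)
have u_small : `|u| <= (b - a) / 2.
  rewrite -(ler_pM2l N2R); apply: le_trans N2t _.
  have : (2 * w)%:R * h%:R * (b - a) <= N%:R ^+ 2 * (b - a).
    by rewrite ler_wpM2r ?(ltW ba0)// expr2 ler_pM.
  by move: tower_ge; rewrite natrM; lra.
have u_M : `|u| <= M%:R^-1.
  rewrite -[leRHS]div1r ler_pdivlMr ?ltr0n// mulrC; apply: le_trans N2t.
  rewrite ler_wpM2r// -natrX ler_nat (leq_trans MN)// -{1}(expn1 N) leq_pexp2l//.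
exists (N * n)%N; split.
  rewrite -{1}(muln1 N) leq_mul2l n0 orbT /= expnS leq_mul2l.
  by rewrite nN orbT.
move=> V mV VP.
(* The points of the base that stay in it when translated by [u]. *)
pose G : set R := `[Num.max a (a - u), Num.min b (b - u)[%classic.
have GP y : G y -> a <= y < b /\ a <= y + u < b.
  rewrite /G /= in_itv /= ge_max lt_min => /andP[/andP[? ?] /andP[? ?]].
  by split; lra.
apply: (@near_identity_tower G V [:: (N * n)%N] M%:R^-1) => //.
- exact: measurable_itv.
- by move=> y Gy; apply/baseE; case: (GP y Gy).
- rewrite lebesgue_measure_itv /= lte_fin.
  have : (b - a) / 2 <= Num.min b (b - u) - Num.max a (a - u).
    have := le_length_meet_translate a b u.
    by apply: le_trans; move: u_small; lra.
  move=> le_ba; rewrite ifT; first by rewrite -EFinB lee_fin.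
  by rewrite -subr_gt0; lra.
- move=> y Gy; have [yI yuI] := GP y Gy; exists (N * n)%N; first exact: mem_head.
  by rewrite tr_mul// -/u (_ : y + u - y = u)//; lra.
Qed.

End InTower.

Lemma near_identity_times N M : let w := (3 * size D).+1 in
  (0 < M <= N)%N -> (2 * w * size D <= N)%N -> (2 * w <= N)%N -> (6 <= N)%N ->
  exists s : seq nat,
  [/\ (size s <= ((size D).+2 * (2 * w).+1).+1)%N,
      forall n, n \in s -> (N <= n <= N ^ N)%N
    & forall V, measurable V ->
      (forall x n, 0 <= x < 1 -> n \in s -> `|iter n T x - x| <= M%:R^-1 -> V x) ->
      ((2 * w)%:R^-1%:E <= mu V)%E].
Proof.
move=> w MN wdN wN N6.
have N0 : (0 < N)%N by exact: leq_trans N6.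
have [|a [b [h [[/andP[a0 ab] b1] off levels free [/andP[h0 hL] tower_ge]]]]] :=
  @tower_exists (N ^ 5); first by rewrite expn_gt0 N0.
case: (ltnP h N) => [hN|Nh].
  have [m [/andP[Nm mN] VP]] :=
    short_tower a0 ab b1 h0 levels free tower_ge MN wN hN off.
  exists [:: m]; split=> // n; rewrite inE => /eqP ->; rewrite Nm /=.
  by rewrite (leq_trans mN)// leq_pexp2l// (leq_trans _ N6).
have [s [size_s sP VP]] := tall_tower a0 ab b1 h0 levels free tower_ge MN Nh.
exists s; split=> // n /sP/andP[Nn nr]; rewrite Nn /= (leq_trans nr)//.
(* Since 2 w |D| <= N, this is at most N^6, and N >= 6 bounds that by N^N. *)
apply: (@leq_trans (2 * w * (N ^ 5 * size D))); first by rewrite leq_mul2l hL orbT.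
rewrite mulnCA mulnC; apply: (@leq_trans (N ^ 6)); last by rewrite leq_pexp2l.
by rewrite (expnS N 5) leq_mul2r wdN orbT.
Qed.

End Dynamics.

Lemma sum_le_const (R : realType) (I : eqType) (s : seq I) (F : I -> \bar R) (e : R) :
  (forall x, x \in s -> (F x <= e%:E)%E) ->
  (\sum_(x <- s) F x <= ((size s)%:R * e)%:E)%E.
Proof.
elim: s => [|x s IHs] Fe; first by rewrite big_nil mul0r.
rewrite big_cons -natr1 mulrDl mul1r addrC EFinD leeD ?Fe ?mem_head//.
by apply: IHs => y ys; rewrite Fe// inE ys orbT.
Qed.

Lemma eventually_forall_seq (I : eqType) (s : seq I) (Q : I -> nat -> Prop) :
  (forall x, x \in s -> exists m, forall n, (m <= n)%N -> Q x n) ->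
  exists m, forall n x, (m <= n)%N -> x \in s -> Q x n.
Proof.
elim: s => [|x s IHs] Qs; first by exists 0%N.
have [|m1 Q1] := IHs; first by move=> y ys; apply: Qs; rewrite inE ys orbT.
have [m2 Q2] := Qs x (mem_head _ _).
exists (maxn m1 m2) => n y; rewrite geq_max inE => /andP[m1n m2n] /orP[/eqP ->|ys].
  exact: Q2.
exact: Q1.
Qed.

(** Encodes a neighbour [j] of [i] by the offset k = j + 1 - i in {0, 1, 2}; the subtraction is
    never truncated as i <= j + 1. *)
Lemma neighbour_offset i j : (j < i.+2)%N -> (i < j.+2)%N ->
  (j.+1 - i < 3)%N /\ (i + (j.+1 - i)).-1 = j.
Proof. by split; lia. Qed.

(** * Cells of length 1 / M and pairs of neighbouring cells *)

Section Cells.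
Context (R : realType) (M : nat) (M_gt0 : (0 < M)%N).

Definition cell (i : nat) : set R :=
  unit_ico `&` `[i%:R / M%:R, i.+1%:R / M%:R[%classic.

(* The second index runs through i - 1, i, i + 1; the truncation at i = 0 only
   repeats the pair (0, 0), and the cell of index M is empty. *)
Definition neighbours : seq (nat * nat) :=
  [seq (i, (i + k).-1) | i <- iota 0 M, k <- iota 0 3].

Lemma size_neighbours : size neighbours = (M * 3)%N.
Proof. by rewrite size_allpairs !size_iota. Qed.

Lemma cell_unit i : cell i `<=` unit_ico. Proof. by move=> x []. Qed.

Lemma measurable_cell i : measurable (cell i).
Proof. by apply: measurableI; exact: measurable_itv. Qed.

Lemma measure_cell_le i : (lebesgue_measure (cell i) <= M%:R^-1%:E)%E.
Proof.
apply: (@le_trans _ _ (lebesgue_measure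
    (`[i%:R / M%:R, i.+1%:R / M%:R[%classic : set R))).
  by apply: le_measure; rewrite ?inE; [exact: measurable_cell|exact: measurable_itv|move=> x []].
rewrite lebesgue_measure_itv /=; case: ifP => _; last by rewrite lee_fin.
by rewrite -EFinB lee_fin -mulrBl -natr1 addrC addKr mul1r.
Qed.

Lemma cell_exists x : 0 <= x < 1 -> exists2 i, (i < M)%N & cell i x.
Proof.
move=> xu; pose c i : R := i%:R / M%:R.
have MR : 0 < M%:R :> R by rewrite ltr0n.
have [||i iM xi] := @piece_exists R M c _ _ x xu.
- by rewrite /c mul0r.
- by rewrite /c divff// gt_eqF.
by exists i => //; split; rewrite /unit_ico /= in_itv.
Qed.

Lemma neighbouring_cells x y : 0 <= x < 1 -> 0 <= y < 1 -> `|y - x| <= M%:R^-1 ->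
  exists2 p, p \in neighbours & cell p.1 x /\ cell p.2 y.
Proof.
move=> xu yu; have [i iM xi] := cell_exists xu; have [j jM yj] := cell_exists yu.
have MR : 0 < M%:R :> R by rewrite ltr0n.
rewrite ler_norml => /andP[xy yx]; exists (i, j) => //.
have [xi1 xi2] : i%:R <= x * M%:R /\ x * M%:R < i.+1%:R.
  by case: xi => _; rewrite /= in_itv /= ler_pdivrMr// ltr_pdivlMr// => /andP[].
have [yj1 yj2] : j%:R <= y * M%:R /\ y * M%:R < j.+1%:R.
  by case: yj => _; rewrite /= in_itv /= ler_pdivrMr// ltr_pdivlMr// => /andP[].
have yxM : y * M%:R <= x * M%:R + 1.
  by rewrite -(ler_pdivlMr _ _ MR) mulrDl mulfK ?gt_eqF// div1r; lra.
have xyM : x * M%:R <= y * M%:R + 1.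
  by rewrite -(ler_pdivlMr _ _ MR) mulrDl mulfK ?gt_eqF// div1r; lra.
have ji : (j < i.+2)%N by rewrite -(ltr_nat R) -(natr1 i.+1); lra.
have ij : (i < j.+2)%N by rewrite -(ltr_nat R) -(natr1 j.+1); lra.
have [k3 kj] := neighbour_offset ji ij.
by apply/allpairsP; exists (i, j.+1 - i)%N; split; rewrite ?mem_iota//= kj.
Qed.

End Cells.

(** * Aperiodicity of minimal transformations *)

Lemma finite_set_proper_closure (R : realType) (A : set R) :
  finite_set A -> ~ (unit_ico `<=` closure A).
Proof.
move=> fA; have /accessible_finite_set_closed/(_ _ fA)/closure_id <- :=
  hausdorff_accessible (@Rhausdorff R).
move=> sub; have := sub_finite_set sub fA.
move=> /finite_set_countable/countable_lebesgue_measure0/eqP.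
by rewrite lebesgue_measure_itv /= lte_fin ltr01 -EFinB subr0 eqe oner_eq0.
Qed.

(** A periodic point has a finite orbit, which is not dense: by injectivity its backward iterates
    have the same period, so they are forward iterates as well. *)
Lemma minimal_aperiodic (R : realType) (T S : R -> R) :
  (forall x : R, 0 <= x < 1 -> 0 <= T x < 1) ->
  (forall x : R, 0 <= x < 1 -> S (T x) = x) ->
  minimal T -> forall (x : R) n, 0 <= x < 1 -> (0 < n)%N -> iter n T x <> x.
Proof.
move=> TU TK Tmin x p xu p0 xp.
have xu' : (unit_ico : set R) x by rewrite /unit_ico /= in_itv.
apply: finite_set_proper_closure (Tmin x xu').
have fixk k y : iter p T y = y -> iter (k * p) T y = y.
  by move=> yp; elim: k => // k IHk; rewrite mulSn iterD IHk.
have forward n : iter n T x \in [seq iter i T x | i <- iota 0 p].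
  rewrite (divn_eq n p) addnC iterD fixk//.
  by apply: map_f; rewrite mem_iota /= ltn_mod.
apply: sub_finite_set (finite_seq [seq iter i T x | i <- iota 0 p]).
move=> y [yu' [n [<-|yx]]]; first exact: forward.
have yu : 0 <= y < 1 by move: yu'; rewrite /unit_ico /= in_itv.
have yp : iter p T y = y.
  apply: (iter_inj TU TK (n := n)) => //; first exact: iter_unit.
  by rewrite -iterD addnC iterD yx.
have := forward (n * p - n)%N.
by rewrite -[X in iter _ T X]yx -iterD subnK ?leq_pmulr// fixk.
Qed.

(** * Mixing against near-identity times *)

Lemma infinite_set_unbounded (A : set nat) n : infinite_set A ->
  exists2 j, A j & (n <= j)%N.
Proof.
move=> infA; apply: contrapT => nA; apply: infA.
apply: (sub_finite_set _ (finite_II n)) => j Aj /=.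
by rewrite ltnNge; apply/negP => nj; apply: nA; exists j.
Qed.

(** The limit is at most 1 / M^2; the factor 2 makes the bound strict, so it holds eventually, and
    for the finitely many pairs at once. *)
Lemma mixing_cells (R : realType) (T : R -> R) (a : nat -> nat) (M : nat) :
  (0 < M)%N -> mixing_sequence T a ->
  exists m, forall n p, (m <= n)%N -> p \in neighbours M ->
  (lebesgue_measure (iter (a n) T @^-1` cell M p.2 `&` cell M p.1 : set R) <=
    (2 / M%:R ^+ 2)%:E)%E.
Proof.
move=> M0 [_ mix]; apply: eventually_forall_seq => p _.
have := mix _ _ (@measurable_cell R M p.2) (@measurable_cell R M p.1)
  (@cell_unit R M p.2) (@cell_unit R M p.1).
have lt : (lebesgue_measure (cell M p.2 : set R) *
    lebesgue_measure (cell M p.1 : set R) < (2 / M%:R ^+ 2)%:E)%E.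
  apply: (@le_lt_trans _ _ (M%:R^-1%:E * M%:R^-1%:E)%E).
    by apply: lee_pmul => //; exact: measure_cell_le.
  rewrite -EFinM lte_fin -invfM -expr2 ltr_pMl ?invr_gt0 ?exprn_gt0 ?ltr0n//.
  by rewrite ltr1n.
move=> /(_ _ (open_nbhs_nbhs (conj (@open_ereal_lt_ereal R _) lt)))[m _ near_m].
by exists m => n mn; apply/ltW; exact: near_m.
Qed.

Theorem proposition1p5 (R : realType) (T : R -> R) :
  is_iet T -> minimal T ->
  ~ exists a : nat -> nat,
      mixing_sequence T a /\ thick (fun j : nat => (j ^ j)%N) a.
Proof.
move=> [d [c [[c0 cd] c_lt T_isom T_homo T_bij]]] Tmin [a [mix [a_incr thick_a]]].
have [T_fun T_inj T_surj] := T_bij.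
have unitE (x : R) : (unit_ico : set R) x = (0 <= x < 1) by rewrite /unit_ico /= in_itv.
have TU (x : R) : 0 <= x < 1 -> 0 <= T x < 1 by rewrite -!unitE; exact: T_fun.
have /choice[S SP] : forall y : R, exists x, 0 <= y < 1 -> 0 <= x < 1 /\ T x = y.
  move=> y; case: (boolP (0 <= y < 1)) => [yu|]; last by exists 0.
  have : (unit_ico : set R) y by rewrite unitE.
  by move=> /T_surj[x]; rewrite unitE => xu <-; exists x.
have SU (x : R) : 0 <= x < 1 -> 0 <= S x < 1 by move=> /SP[].
have SK (x : R) : 0 <= x < 1 -> T (S x) = x by move=> /SP[].
have TK (x : R) : 0 <= x < 1 -> S (T x) = x.
  move=> xu; apply: T_inj; rewrite ?inE ?unitE//; first exact/SU/TU.
  exact/SK/TU.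
pose D := [seq c i | i <- iota 0 d].
have d0 : (0 < d)%N.
  by rewrite lt0n; apply/eqP => d0; move: cd; rewrite d0 c0 => /eqP; rewrite eq_sym oner_eq0.
have D0 : 0 \in D by rewrite -c0; apply: map_f; rewrite mem_iota.
have D_unit e : e \in D -> 0 <= e < 1.
  move=> /mapP[i]; rewrite mem_iota add0n => /andP[_ id] ->.
  rewrite -{1}c0 (cut_le c_lt) ?(ltnW id)//= -cd.
  by rewrite (lt_le_trans (c_lt _ id))// (cut_le c_lt)// id leqnn.
pose w := (3 * size D).+1; pose Q := ((size D).+2 * (2 * w).+1).+1.
(* Up to [Q] times will each contribute measure at most 6 / M, and M > 12 w Q keeps the total below
   1 / (2 w). *)
pose M := (12 * w * Q).+1.
have [m0 mixed] := mixing_cells (ltn0Sn _ : (0 < M)%N) mix.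
(* The summand [a m0] ensures that mixing times from [N] on have index at least [m0]; the others
   meet the size conditions on [N]. *)
pose K := (M + 2 * w * size D + 2 * w + 6 + a m0)%N.
have [N thickN KN] := infinite_set_unbounded K thick_a.
have [|||| s [size_s sN]] := near_identity_times TU SU TK SK D0 D_unit
  (translation_off_cuts c0 cd c_lt T_isom T_homo)
  (minimal_aperiodic TU TK Tmin)
  (image_measure_ge c0 cd c_lt T_isom T_homo T_bij)
  (preimage_measurable c0 cd c_lt T_isom T_homo) (N := N) (M := M).
- by rewrite /=; lia.
- by rewrite -/w; lia.
- by rewrite -/w; lia.
- by lia.
rewrite -/w -/Q in size_s *; move=> le_all.
pose F n (p : nat * nat) : set R := iter n T @^-1` cell M p.2 `&` cell M p.1.
have mF n p : measurable (F n p).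
  rewrite (_ : F n p = (unit_ico `&` iter n T @^-1` cell M p.2) `&` cell M p.1).
    apply: measurableI (@measurable_cell _ _ _).
    apply: (iter_preimage TU) (@measurable_cell _ _ _) (@cell_unit _ _ _) => A.
    exact: (preimage_measurable c0 cd c_lt T_isom T_homo).
  apply/seteqP; split=> x; last by move=> [[]].
  by move=> [Tx cx]; split=> //; split=> //; exact: cell_unit cx.
(* [G n] contains every point of [0, 1) that [iter n T] moves by at most 1 / M. *)
pose G n := \big[setU/set0]_(p <- neighbours M) F n p.
have mG n : measurable (G n) by apply: bigsetU_measurable.
set V := \big[setU/set0]_(n <- s) G n.
have : ((2 * w)%:R^-1%:E <= lebesgue_measure (V : set R))%E.
  apply: le_all; first exact: bigsetU_measurable.
  move=> x n xu ns near_x.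
  have [p pM [px pTx]] :=
    neighbouring_cells (ltn0Sn _ : (0 < M)%N) xu (iter_unit TU n xu) near_x.
  by rewrite /V -bigcup_seq; exists n => //; rewrite /G -bigcup_seq; exists p.
apply/negP; rewrite -ltNge.
have le_G n : n \in s -> (lebesgue_measure (G n) <= (6 / M%:R)%:E)%E.
  move=> /sN nN; have [m _ am] : range a n by apply: thickN.
  have m0m : (m0 <= m)%N.
    rewrite leqNgt; apply/negP => /a_incr; rewrite am => am0.
    by move: nN; lia.
  apply: le_trans (measure_bigsetU_le (@lebesgue_measure R) _ (mF n)) _.
  apply: le_trans (sum_le_const (e := 2 / M%:R ^+ 2) _) _.
    by move=> p pM; rewrite /F -am; exact: mixed.
  (* There are 3 M pairs, each contributing at most 2 / M^2. *)
  rewrite lee_fin size_neighbours natrM.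
  have simpl_frac (x : R) : x != 0 -> x * 3 * (2 / x ^+ 2) = 6 / x by move=> x0; field.
  by rewrite simpl_frac// pnatr_eq0.
apply: le_lt_trans (measure_bigsetU_le (@lebesgue_measure R) _ mG) _.
apply: le_lt_trans (sum_le_const le_G) _.
rewrite lte_fin; apply: (@le_lt_trans _ _ (Q%:R * (6 / M%:R))).
  by rewrite ler_wpM2r ?divr_ge0// ler_nat.
rewrite mulrA ltr_pdivrMr ?ltr0n// -ltr_pdivrMl ?invr_gt0 ?ltr0n// invrK.
by rewrite -!natrM ltr_nat /M; lia.
Qed.
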